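(* Let $d=d(n)$ be an integer-valued function of $n$ with $d(n)\ge 1$ for all $n$ and $d(n)=o(n^{1/3})$ as $n\to\infty$. Then there exists $N$ such that for all integers $n\ge N$, writing $d=d(n)$, for each graph $G\in\mathcal G_n(d)$ that is not isomorphic to $K^*_{d,n-d}$ we have $$\mathbb E(X(G))<\mathbb E(X(K^*_{d,n-d}))<\frac{n-d}{2}.$$
   Context: Graphs are finite and simple. For integers $n$ and $d\ge 0$, $\mathcal G_n(d)$ denotes the set of graphs with $n$ vertices and minimum degree at least $d$. $K^*_{a,b}$ denotes the graph obtained from the disjoint union of a complete graph on $a$ vertices and an edgeless graph on $b$ vertices by adding all edges between the two vertex sets. $X(G)$ denotes the random variable equal to the size of an independent set chosen uniformly at random from the set of all independent sets of $G$ (including the empty set). *)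

(* Defs.v *)
(* MathComp / MathComp-Analysis. *)
From HB Require Import structures.
From mathcomp Require Import all_boot all_order all_algebra.
From mathcomp Require Import all_classical all_reals all_analysis.

Set Implicit Arguments.
Unset Strict Implicit.
Unset Printing Implicit Defensive.

Import Order.TTheory GRing.Theory Num.Theory.

Record sgraph := SGraph {
  vertex :> finType;
  adj : rel vertex;
  adj_sym : symmetric adj;
  adj_irr : irreflexive adj }.

Definition isomorphic (G H : sgraph) : Prop :=
  exists f : G -> H, bijective f /\ {mono f : x y / adj x y}.

Definition degree (G : sgraph) (x : G) : nat := #|[set y : G | adj x y]|.

(* Degrees are smaller than #|G|, so the default value #|G| only matters for
   the empty graph, whose minimum degree is then 0. *)
Definition min_degree (G : sgraph) : nat :=
  \big[minn/#|G|]_(x : G) degree x.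

(* The class of graphs with n vertices and minimum degree at least d. *)
Definition in_class (n d : nat) (G : sgraph) : Prop :=
  #|G| = n /\ (d <= min_degree G)%N.

Definition complete_adj (n : nat) : rel 'I_n := fun x y => x != y.

Lemma complete_adj_sym n : symmetric (@complete_adj n).
Proof. by move=> x y; rewrite /complete_adj eq_sym. Qed.

Lemma complete_adj_irr n : irreflexive (@complete_adj n).
Proof. by move=> x; rewrite /complete_adj eqxx. Qed.

Definition complete_graph (n : nat) : sgraph :=
  SGraph (@complete_adj_sym n) (@complete_adj_irr n).

Definition edgeless_adj (n : nat) : rel 'I_n := fun _ _ => false.

Lemma edgeless_adj_sym n : symmetric (@edgeless_adj n).
Proof. by []. Qed.

Lemma edgeless_adj_irr n : irreflexive (@edgeless_adj n).
Proof. by []. Qed.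

Definition edgeless_graph (n : nat) : sgraph :=
  SGraph (@edgeless_adj_sym n) (@edgeless_adj_irr n).

(* Disjoint union of G and H together with all edges between G and H. *)
Definition join_adj (G H : sgraph) : rel (G + H) := fun u v =>
  match u, v with
  | inl x, inl y => adj x y
  | inr x, inr y => adj x y
  | _, _ => true
  end.

Lemma join_adj_sym G H : symmetric (@join_adj G H).
Proof. by move=> [x|x] [y|y] //=; apply: adj_sym. Qed.

Lemma join_adj_irr G H : irreflexive (@join_adj G H).
Proof. by move=> [x|x] /=; apply: adj_irr. Qed.

Definition join_graph (G H : sgraph) : sgraph :=
  SGraph (@join_adj_sym G H) (@join_adj_irr G H).

Definition Kstar (a b : nat) : sgraph :=
  join_graph (complete_graph a) (edgeless_graph b).

Definition independent (G : sgraph) (S : {set G}) : bool :=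
  [forall x in S, forall y in S, ~~ adj x y].

Definition indep_sets (G : sgraph) : {set {set G}} :=
  [set S : {set G} | independent S].

Local Open Scope ring_scope.

(* Probability mass function of the uniform distribution on a nonempty A. *)
Definition uniform_pmf (R : realType) (T : finType) (A : {set T}) (x : T) : R :=
  if x \in A then #|A|%:R^-1 else 0.

Definition expectation_pmf (R : realType) (T : finType) (p X : T -> R) : R :=
  \sum_(x : T) p x * X x.

(* E(X(G)): the expected size of a uniformly random independent set of G. *)
Definition EX (R : realType) (G : sgraph) : R :=
  expectation_pmf (uniform_pmf R (indep_sets G)) (fun S : {set G} => #|S|%:R).

(* Main.v *)
(* Write [N(I)] for the set of vertices with a neighbour in [I], [i] for the
   number of independent sets and [F] for the sum of [|N(I)|] over them.
   Toggling a vertex [v] gives [2 * sum |I| + F = n * i], so maximizing the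
   expected size means minimizing the average [F / i] of [|N(I)|].  Every
   nonempty [I] has [|N(I)| >= d]; if equality holds, [I] is "tight" and consists
   of vertices sharing the same [d]-element neighbourhood.  Let [v] be a vertex of
   degree [d] with the largest class [C] of such twins.  If [C] and [N(v)] do not
   cover [G], then adding an outside vertex to the subsets of [C] shows that the
   loose sets are not much fewer than the tight ones, which is far more than the
   exponentially small slack [d (n - 2 - d) / (2^(n-d) + d)] of [K*].  If they do
   cover [G], then [G] is [K*] up to missing edges inside [N(v)], and each extra
   independent set inside [N(v)] has all of [C] as neighbours. *)
Require Import Defs.
From mathcomp Require Import all_boot all_order all_algebra.
From mathcomp Require Import zify ring lra.
Set Implicit Arguments.
Unset Strict Implicit.
Unset Printing Implicit Defensive.
Import Order.TTheory GRing.Theory Num.Theory.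

(** * Counting over finite sets *)

Section FiniteSets.

Variable T : finType.
Implicit Types A B : {set T}.
Local Open Scope nat_scope.

Lemma sum_setU_disjoint A B (F : T -> nat) : [disjoint A & B] ->
  \sum_(i in A :|: B) F i = \sum_(i in A) F i + \sum_(i in B) F i.
Proof.
by move=> AB; rewrite -bigU //=; apply: eq_bigl => i; rewrite !inE.
Qed.

Lemma card_bigcup_le (I : finType) (P : pred I) (F : I -> {set T}) :
  #|\bigcup_(i | P i) F i| <= \sum_(i | P i) #|F i|.
Proof.
elim/big_rec2: _ => [|i m A _ Am]; first by rewrite cards0.
by rewrite cardsU (leq_trans (leq_subr _ _)) // leq_add2l.
Qed.

Lemma sum_card_mem (P : {set {set T}}) (f : {set T} -> {set T}) :
  \sum_(I in P) #|f I| = \sum_v #|[set I in P | v \in f I]|.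
Proof.
transitivity (\sum_(I in P) \sum_(v : T) (v \in f I)).
  by apply: eq_bigr => I _; rewrite -sum1_card [LHS]big_mkcond.
rewrite exchange_big; apply: eq_bigr => v _.
rewrite -big_mkcondr /= sum1dep_card; apply: eq_card => I; by rewrite !inE.
Qed.

End FiniteSets.

(** * Neighbourhoods and the toggling identity *)

Section Neighborhoods.

Variable G : sgraph.
Implicit Types (x y v : G) (I J : {set G}).
Local Open Scope nat_scope.

Definition nbh v : {set G} := [set y | adj v y].

Definition nbhs_of I : {set G} := \bigcup_(x in I) nbh x.

Definition nbh_sum : nat := \sum_(I in indep_sets G) #|nbhs_of I|.

Lemma in_nbh v y : (y \in nbh v) = adj v y.
Proof. by rewrite inE. Qed.

Lemma nbh_sym v y : (y \in nbh v) = (v \in nbh y).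
Proof. by rewrite !in_nbh adj_sym. Qed.

Lemma nbh_irr v : v \notin nbh v.
Proof. by rewrite in_nbh adj_irr. Qed.

Lemma nbhs_of0 : nbhs_of set0 = set0.
Proof. exact: big_set0. Qed.

Lemma nbhs_of1 v : nbhs_of [set v] = nbh v.
Proof. exact: big_set1. Qed.

Lemma nbh_sub_nbhs_of v I : v \in I -> nbh v \subset nbhs_of I.
Proof. by move=> vI; apply: (bigcup_sup v). Qed.

Lemma min_degree_le v : min_degree G <= #|nbh v|.
Proof.
rewrite /min_degree; have: v \in index_enum G by rewrite mem_index_enum.
elim: (index_enum G) => // x s IH; rewrite inE big_cons => /predU1P[->|/IH].
  exact: geq_minl.
exact/leq_trans/geq_minr.
Qed.

Lemma independentP I :
  reflect {in I &, forall x y, ~~ adj x y} (independent I).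
Proof.
apply: (iffP forall_inP) => [h x y xI yI|h x xI].
  by move/forall_inP: (h x xI); apply.
by apply/forall_inP => y yI; apply: h.
Qed.

Lemma independent1 v : independent [set v].
Proof. by apply/independentP => x y /set1P -> /set1P ->; rewrite adj_irr. Qed.

Lemma independentU1 v I :
  independent (v |: I) = independent I && (v \notin nbhs_of I).
Proof.
apply/independentP/andP => [h|[/independentP hI vN] x y].
  split.
    by apply/independentP => x y xI yI; apply: h; rewrite !inE ?xI ?yI orbT.
  apply/bigcupP => -[x xI]; rewrite in_nbh; apply/negP.
  by apply: h; rewrite !inE ?xI ?eqxx ?orbT.
have vI z : z \in I -> ~~ adj z v.
  by move=> zI; apply: contra vN => zv; apply/bigcupP; exists z; rewrite ?in_nbh.
case/setU1P=> [->|xI] /setU1P[->|yI]; first by rewrite adj_irr.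
- by rewrite adj_sym vI.
- exact: vI.
- exact: hI.
Qed.

Lemma indep_notin_nbhs_of v I :
  independent I -> v \in I -> v \notin nbhs_of I.
Proof.
move=> iI vI; have : independent (v |: I).
  by rewrite (setUidPr _) ?sub1set.
by rewrite independentU1 => /andP[].
Qed.

Lemma independent_pair x y : ~~ adj x y -> independent [set x; y].
Proof. by move=> nxy; rewrite independentU1 independent1 nbhs_of1 in_nbh adj_sym. Qed.

(* Toggling [v] is a bijection between the two families. *)
Lemma card_indep_toggle v :
  #|[set I in indep_sets G | v \in I]| =
  #|[set I in indep_sets G | (v \notin I) && (v \notin nbhs_of I)]|.
Proof.
set B := [set I in _ | (_ && _)].
rewrite -(@card_in_imset _ _ (fun I => v |: I) B); last first.
  move=> I J; rewrite !inE => /and3P[_ vI _] /and3P[_ vJ _] e.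
  by rewrite -(setU1K vI) -(setU1K vJ) e.
apply: eq_card => I; apply/idP/imsetP.
  rewrite !inE => /andP[iI vI]; exists (I :\ v); last by rewrite setD1K.
  move: iI; rewrite -{1}(setD1K vI) independentU1 => /andP[h1 h2].
  by rewrite !inE eqxx h1 h2.
case=> J; rewrite !inE => /and3P[iJ _ vNJ] ->.
by rewrite independentU1 iJ vNJ !inE eqxx.
Qed.

(** For a fixed [v], an independent set contains [v], or has [v] in its neighbourhood, or neither.
    Toggling equates the first and third counts, so two copies of the first plus the second give all
    independent sets; then sum over [v]. *)
Lemma sum_card_indep :
  2 * (\sum_(I in indep_sets G) #|I|) + nbh_sum = #|G| * #|indep_sets G|.
Proof.
rewrite /nbh_sum (@sum_card_mem _ _ id) (@sum_card_mem _ _ nbhs_of).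
rewrite mul2n -addnn {2}(eq_bigr _ (fun v _ => card_indep_toggle v)).
rewrite -!big_split /= -sum_nat_const; apply: eq_bigr => v _.
set A := [set I in indep_sets G | v \in I].
set B := [set I in indep_sets G | (v \notin I) && (v \notin nbhs_of I)].
set C := [set I in indep_sets G | v \in nbhs_of I].
rewrite -(cardsID A (indep_sets G)) -(cardsID B (_ :\: A)) -addnA.
congr (_ + (_ + _)).
- by apply: eq_card => I; rewrite !inE; case: (independent I).
- by apply: eq_card => I; rewrite !inE; case: (independent I); case: (v \in I);
    case: (_ \in _).
- apply: eq_card => I; rewrite !inE.
  have [iI|] := boolP (independent I); last by rewrite !andbF.
  have [vI|_] := boolP (v \in I); last by case: (_ \in _).
  by rewrite (negPf (indep_notin_nbhs_of iI vI)).
Qed.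

End Neighborhoods.

(** * Graphs that are [K*] up to edges missing inside [D] *)

Section JoinStructure.

Variables (G : sgraph) (D : {set G}).
Hypothesis nbhD : forall x, x \notin D -> nbh x = D.
Local Open Scope nat_scope.

(** The empty set is left out because it is counted among the subsets of the complement of [D]. *)
Definition indep_in : {set {set G}} :=
  [set J in indep_sets G | (J \subset D) && (J != set0)].

Lemma join_nbhs_of (I : {set G}) :
  I \subset ~: D -> I != set0 -> nbhs_of I = D.
Proof.
move=> /fintype.subsetP ID /set0Pn[x xI].
have h y : y \in I -> nbh y = D by move=> /ID; rewrite inE => /nbhD.
apply/eqP; rewrite finset.eqEsubset -{2}(h x xI) nbh_sub_nbhs_of // andbT.
by apply/bigcupsP => y /h ->.
Qed.

(** The complement of [D] is edgeless and joined completely to [D], so an independent set cannot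
    meet both sides. *)
Lemma join_indep_split :
  indep_sets G = powerset (~: D) :|: indep_in.
Proof.
apply/setP => I; rewrite !inE.
have [ID|/subsetPn[x xI]] /= := boolP (I \subset ~: D).
  apply/independentP => x y xI yI.
  have := fintype.subsetP ID x xI; rewrite inE => /nbhD xD.
  by have := fintype.subsetP ID y yI; rewrite inE -xD in_nbh.
rewrite inE negbK => xD; have -> : I != set0 by apply/set0Pn; exists x.
rewrite andbT; have [iI|] //= := boolP (independent I).
apply/esym/fintype.subsetP => y yI; apply: contraT => yD.
have := independentP _ iI y x yI xI.
by rewrite -in_nbh (nbhD yD) xD.
Qed.

Lemma join_indep_disjoint : powerset (~: D) :&: indep_in = set0.
Proof.
apply/setP => I; rewrite !inE; apply/negbTE/negP.
case/and4P=> /fintype.subsetP h1 _ /fintype.subsetP h2 /set0Pn[x xI].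
by have := h1 x xI; rewrite inE h2.
Qed.

Lemma join_card_indep : #|indep_sets G| = 2 ^ (#|G| - #|D|) + #|indep_in|.
Proof.
rewrite join_indep_split cardsU join_indep_disjoint cards0 subn0.
by rewrite card_powerset cardsCs setCK.
Qed.

Lemma join_nbh_sum :
  nbh_sum G = #|D| * (2 ^ (#|G| - #|D|) - 1)
              + \sum_(J in indep_in) #|nbhs_of J|.
Proof.
rewrite /nbh_sum join_indep_split sum_setU_disjoint /=; last first.
  by rewrite -setI_eq0 join_indep_disjoint.
congr (_ + _); rewrite (big_setD1 set0) ?inE ?sub0set //= nbhs_of0 cards0 add0n.
rewrite (eq_bigr (fun=> #|D|)) => [|I]; last first.
  by rewrite !inE => /andP[I0 ID]; rewrite join_nbhs_of.
rewrite sum_nat_const mulnC; congr (_ * _).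
by rewrite cardsDS ?sub1set ?inE ?sub0set // cards1 card_powerset cardsCs setCK.
Qed.

(** A single vertex of [D] is already adjacent to everything outside [D]. *)
Lemma join_nbhs_of_ge (J : {set G}) :
  J \in indep_in -> #|G| - #|D| <= #|nbhs_of J|.
Proof.
rewrite !inE => /and3P[_ /fintype.subsetP JD /set0Pn[x xJ]].
have -> : #|G| - #|D| = #|~: D| by rewrite [RHS]cardsCs setCK.
apply: subset_leq_card; apply: fintype.subset_trans (nbh_sub_nbhs_of xJ).
by apply/fintype.subsetP => y; rewrite inE nbh_sym => /nbhD ->; apply: JD.
Qed.

Lemma join_singletons : set1 @: D \subset indep_in.
Proof.
apply/fintype.subsetP => _ /imsetP[x xD ->].
by rewrite !inE independent1 sub1set xD; apply/set0Pn; exists x; rewrite inE.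
Qed.

(** The singletons account for [#|D|] sets; the non-adjacent pair is one more. *)
Lemma join_card_indep_in_gt (x y : G) :
  x \in D -> y \in D -> x != y -> ~~ adj x y -> #|D| < #|indep_in|.
Proof.
move=> xD yD xy nxy; rewrite -(card_imset _ set1_inj).
apply: proper_card; rewrite properE join_singletons /=.
apply/subsetPn; exists [set x; y].
  rewrite !inE independent_pair // subUset !sub1set xD yD.
  by apply/set0Pn; exists x; rewrite !inE eqxx.
apply/imsetP => -[z _ e].
by have := cards2 x y; rewrite e cards1 xy.
Qed.

Lemma join_complete_indep_in :
  {in D &, forall x y, x != y -> adj x y} -> indep_in = set1 @: D.
Proof.
move=> hD; apply/eqP; rewrite finset.eqEsubset join_singletons andbT.
apply/fintype.subsetP => J.
rewrite !inE => /and3P[/independentP iJ /fintype.subsetP JD /set0Pn[x xJ]].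
apply/imsetP; exists x; first exact: JD.
apply/setP => y; rewrite inE; apply/idP/eqP => [yJ|-> //].
apply/eqP; apply: contraT => yx.
by have := iJ y x yJ xJ; rewrite hD ?JD.
Qed.

Lemma join_complete_nbh_sum :
  {in D &, forall x y, x != y -> adj x y} ->
  \sum_(J in indep_in) #|nbhs_of J| = #|D| * (#|G| - 1).
Proof.
move=> hD; rewrite join_complete_indep_in // big_imset /=; last first.
  by move=> x y _ _; apply: set1_inj.
rewrite -sum_nat_const; apply: eq_bigr => x xD; rewrite nbhs_of1.
have -> : nbh x = ~: [set x].
  apply/setP => y; rewrite in_nbh !inE; have [->|yx] := eqVneq y x.
    exact: adj_irr.
  have [yD|yD] := boolP (y \in D); first by rewrite hD // eq_sym.
  by rewrite -in_nbh nbh_sym nbhD.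
by rewrite cardsCs setCK cards1.
Qed.

End JoinStructure.

(** * Tight and loose independent sets *)

Section Tight.

Variables (G : sgraph) (d : nat).
Hypothesis deg_ge : forall v : G, d <= #|nbh v|.
Local Open Scope nat_scope.

Definition twins (v : G) : {set G} := [set u | nbh u == nbh v].

(** Under [deg_ge] the bound amounts to equality for nonempty sets; the empty set, whose
    neighbourhood is empty, is treated separately. *)
Definition tight : {set {set G}} :=
  [set I in indep_sets G | (I != set0) && (#|nbhs_of I| <= d)].

Definition loose : {set {set G}} :=
  [set I in indep_sets G | d < #|nbhs_of I|].

Lemma indep_sets_tight_loose :
  indep_sets G = set0 |: (tight :|: loose).
Proof.
apply/setP => I; rewrite !inE; have [->|I0] /= := eqVneq I set0.
  by apply/independentP => x y; rewrite inE.
by case: leqP => _; rewrite ?andbT ?andbF ?orbF.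
Qed.

Lemma tight_loose_disjoint : [disjoint tight & loose].
Proof.
rewrite -setI_eq0; apply/eqP/setP => I; rewrite !inE.
by case: leqP => _; rewrite ?andbT ?andbF.
Qed.

Lemma set0_notin_tight_loose : set0 \notin tight :|: loose.
Proof. by rewrite !inE eqxx nbhs_of0 cards0 ltn0 !andbF. Qed.

Lemma card_indep_tight_loose :
  #|indep_sets G| = #|tight| + #|loose| + 1.
Proof.
rewrite indep_sets_tight_loose cardsU1 set0_notin_tight_loose cardsU.
by rewrite (disjoint_setI0 tight_loose_disjoint) cards0 subn0 addnC.
Qed.

Lemma nbhs_of_ge (I : {set G}) : I != set0 -> d <= #|nbhs_of I|.
Proof.
case/set0Pn=> x xI; apply: leq_trans (deg_ge x) _.
exact/subset_leq_card/nbh_sub_nbhs_of.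
Qed.

Lemma nbh_sum_ge : d * #|tight| + d.+1 * #|loose| <= nbh_sum G.
Proof.
rewrite /nbh_sum indep_sets_tight_loose big_setU1 ?set0_notin_tight_loose //=.
rewrite nbhs_of0 cards0 add0n sum_setU_disjoint ?tight_loose_disjoint //=.
rewrite mulnC -sum_nat_const [_.+1 * _]mulnC -sum_nat_const.
apply: leq_add; apply: leq_sum => I; rewrite !inE.
  by case/and3P=> _ I0 _; apply: nbhs_of_ge.
by case/andP.
Qed.

(** [nbh v] lies inside [nbhs_of I], has at least [d] elements, and [nbhs_of I] has at most [d]. *)
Lemma tight_nbh (I : {set G}) v : I \in tight -> v \in I ->
  nbh v = nbhs_of I /\ #|nbh v| = d.
Proof.
rewrite !inE => /and3P[_ _ Id] vI; have sub := nbh_sub_nbhs_of vI.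
have e : nbh v = nbhs_of I.
  by apply/eqP; rewrite eqEcard sub (leq_trans Id).
by split=> //; apply/eqP; rewrite eqn_leq deg_ge e Id.
Qed.

(** A tight set lies in the twin class of any of its vertices, so it is one of at most [2 ^ c]
    subsets attached to that vertex. *)
Lemma card_tight_le c :
  (forall v, #|nbh v| = d -> #|twins v| <= c) -> #|tight| <= #|G| * 2 ^ c.
Proof.
move=> hc.
have sub : tight \subset \bigcup_(v | #|nbh v| == d) powerset (twins v).
  apply/fintype.subsetP => I tI; have := tI; rewrite !inE => /and3P[_ /set0Pn[v vI] _].
  have [e dv] := tight_nbh tI vI; apply/bigcupP; exists v; first exact/eqP.
  rewrite inE; apply/fintype.subsetP => u uI.
  by rewrite inE e; have [-> _] := tight_nbh tI uI.
apply: leq_trans (subset_leq_card sub) _.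
apply: leq_trans (card_bigcup_le _ _) _.
apply: (@leq_trans (\sum_(v : G | #|nbh v| == d) 2 ^ c)).
  apply: leq_sum => v /eqP dv; rewrite card_powerset leq_pexp2l //.
  exact: hc.
by rewrite sum_nat_const leq_mul2r max_card orbT.
Qed.

Lemma loose_of_distinct_nbh (I : {set G}) u v : independent I -> u \in I -> v \in I ->
  nbh u != nbh v -> I \in loose.
Proof.
move=> iI uI vI uv; rewrite !inE iI /= ltnNge; apply: contra uv => Id.
have tI : I \in tight.
  by rewrite !inE iI Id andbT; apply/set0Pn; exists u.
by rewrite (tight_nbh tI uI).1 (tight_nbh tI vI).1.
Qed.

Lemma card_loose_ge_order :
  (forall v : G, d < #|nbh v|) -> #|G| <= #|loose|.
Proof.
move=> hd; rewrite -cardsT -(card_imset _ set1_inj); apply: subset_leq_card.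
apply/fintype.subsetP => _ /imsetP[v _ ->].
by rewrite !inE independent1 nbhs_of1 hd.
Qed.

(** Each [u] outside [nbh v] and [twins v] gives a loose pair [[set v; u]]. This bound is strong
    when the twin class is small. *)
Lemma card_loose_ge_pairs v :
  #|nbh v| = d -> #|G| - d - #|twins v| <= #|loose|.
Proof.
move=> dv; set U := ~: (nbh v :|: twins v).
have leU : #|G| - d - #|twins v| <= #|U|.
  by rewrite [#|U|]cardsCs setCK -subnDA leq_sub2l // -dv cardsU leq_subr.
apply: leq_trans leU _.
have injf : {in U &, injective (fun u => [set v; u])}.
  move=> x y; rewrite !inE !negb_or => /andP[_ xv] /andP[_ yv] e.
  have: x \in [set v; y] by rewrite -e !inE eqxx orbT.
  by rewrite !inE => /predU1P[xe|/eqP //]; rewrite xe eqxx in xv.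
rewrite -(card_in_imset injf); apply: subset_leq_card.
apply/fintype.subsetP => _ /imsetP[u uU ->].
have /andP[nvu uv] : (~~ adj v u) && (nbh u != nbh v).
  by move: uU; rewrite !inE negb_or.
by apply: (@loose_of_distinct_nbh _ u v); rewrite ?independent_pair // !inE eqxx ?orbT.
Qed.

(** Twins of [v] are non-adjacent to [w] because [v] is, so adding [w] to a nonempty set of twins
    keeps it independent and makes it loose. The [- 1] discards the empty set of twins. *)
Lemma card_loose_ge_twins v w :
  #|nbh v| = d -> w \notin nbh v -> w \notin twins v ->
  2 ^ #|twins v| - 1 <= #|loose|.
Proof.
move=> dv wN wT; rewrite -card_powerset (cardsD1 set0) inE sub0set addKn.
have tw u : u \in twins v -> nbh u = nbh v by rewrite inE => /eqP.
have injf : {in powerset (twins v) :\ set0 &, injective (fun S => w |: S)}.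
  have wS S : S \in powerset (twins v) :\ set0 -> w \notin S.
    rewrite !inE => /andP[_ /fintype.subsetP ST]; exact: contra (@ST w) wT.
  by move=> S S' /wS wS1 /wS wS2 e; rewrite -(setU1K wS1) e setU1K.
rewrite -(card_in_imset injf); apply: subset_leq_card.
apply/fintype.subsetP => _ /imsetP[S + ->].
rewrite in_setD1 powersetE => /andP[/set0Pn[u uS] /fintype.subsetP ST].
have iS : independent S.
  apply/independentP => x y xS yS.
  by rewrite -in_nbh (tw x (ST x xS)) -(tw y (ST y yS)) nbh_irr.
have wNS : w \notin nbhs_of S.
  by apply/bigcupP => -[x xS]; rewrite (tw x (ST x xS)); apply/negP.
apply: (@loose_of_distinct_nbh _ u w); rewrite ?independentU1 ?iS // ?inE ?uS ?eqxx ?orbT //.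
by apply: contra wT => /eqP e; rewrite inE -e (tw u (ST u uS)).
Qed.

End Tight.

(** * Numerical inequalities *)

Section Arithmetic.

Local Open Scope nat_scope.

Lemma cube_le_expn2 m : 10 <= m -> m ^ 3 <= 2 ^ m.
Proof.
elim: m => // m IH; rewrite ltnS leq_eqVlt => /predU1P[<- //|m10].
by have := IH m10; rewrite (expnS 2 m) !expnS !expn0; nia.
Qed.

Lemma join_arith d m M t :
  0 < d -> d ^ 2 < m -> d ^ 2 * (d + 2) < M -> d < t ->
  (M + t) * (d * (M + (m + d) - 2)) < (d * (M - 1) + t * m) * (M + d).
Proof.
move=> d0 dm dM dt.
have [p mE] : exists p, m = d ^ 2 + 1 + p by exists (m - (d ^ 2 + 1)); lia.
have [s tE] : exists s, t = d + 1 + s by exists (t - (d + 1)); lia.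
have [e dE] : exists e, d = e + 1 by exists (d - 1); lia.
have h1 : d ^ 2 * (d + 2 + s) < M * (1 + s).
  by rewrite mulnDr [M * _]mulnDr muln1 -addSn leq_add // leq_mul2r; apply/orP; right; nia.
(* The [M ^ 2] terms of the goal cancel; the right-hand side here is the part of the difference
   linear in [M], with [d ^ 2 - d + 1 = e ^ 2 + e + 1]. The terms free of [M] are absorbed by
   [h1]. *)
have h2 : M * (1 + s) <= M * (1 + p + s * (e ^ 2 + e + 1 + p)).
  by rewrite leq_mul2l; apply/orP; right; nia.
have [N ME] : exists N, M = N + 1 by exists (M - 1); lia.
have -> : M + (m + d) - 2 = N + m + e by lia.
have -> : M - 1 = N by lia.
move: h1 h2; subst; rewrite !expnS !expn0.
lia.
Qed.

(** [A] and [B] count tight and loose sets. The loose sets lift [F] above [d * (A + B + 1)] by at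
    least [B - d]; times [M], this outweighs [(A + B + 1) * (d * n)] since [A] is at most
    [n * (B + 1)]. *)
Lemma loose_arith n d M A B F :
  0 < d -> 2 * d + 2 <= B -> A <= n * (B + 1) -> 2 * (n + 2) * (d * n) <= M ->
  d * A + d.+1 * B <= F ->
  (A + B + 1) * (d * (M + n - 2)) < F * (M + d).
Proof.
move=> d0 dB AB nM hF.
(* [b + 1 = B - d] is the surplus left once the empty set, which adds nothing to [F], is made up for
   by [d]. *)
have [b Bb] : exists b, B = d + 1 + b by exists (B - (d + 1)); lia.
apply: (@leq_trans ((d * A + d.+1 * B) * (M + d))); last by rewrite leq_mul2r hF orbT.
have h1 : (A + B + 1) * (d * n) <= (b + 1) * M.
  apply: (@leq_trans ((n + 1) * (B + 1) * (d * n))).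
    by rewrite leq_mul2r; apply/orP; right; lia.
  apply: (@leq_trans ((b + 1) * (2 * (n + 2) * (d * n)))).
    rewrite !mulnA leq_mul2r; apply/orP; right; rewrite leq_mul2r; apply/orP; right.
    by nia.
  by rewrite leq_mul2l nM orbT.
have h2 : (A + B + 1) * (d * (M + n - 2)) <= (A + B + 1) * (d * M) + (b + 1) * M.
  apply: leq_trans (leq_add (leqnn _) h1).
  by rewrite -mulnDr leq_mul2l -mulnDr leq_mul2l leq_subr !orbT.
apply: leq_ltn_trans h2 _; subst B.
by nia.
Qed.

Lemma order_arith n d :
  0 < d -> 64 <= n -> 64 * d ^ 3 <= n ->
  [/\ d ^ 2 < n - d, d ^ 2 * (d + 2) < 2 ^ (n - d), 5 * d + 4 <= n
    & 2 * (n + 2) * (d * n) <= 2 ^ (n - d)].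
Proof.
move=> d0 n64 dn; have d23 : d <= d ^ 2 <= d ^ 3.
  by rewrite -{1}(expn1 d) !leq_pexp2l.
have m10 : 10 <= n - d by lia.
have := cube_le_expn2 m10; set m := n - d => hm.
have nm : n <= 2 * m by rewrite /m; lia.
have h1 : m ^ 2 <= 2 ^ m by apply: leq_trans hm; rewrite leq_pexp2l //; lia.
have h0 : m <= 2 ^ m by apply: leq_trans hm; rewrite -{1}(expn1 m) leq_pexp2l //; lia.
split; [by rewrite /m; lia| |by lia|].
- apply: leq_trans h0; rewrite mulnDr -expnSr; lia.
- apply: leq_trans hm.
  apply: (@leq_trans (2 * (2 * n) * (d * n))).
    by rewrite leq_mul2r leq_mul2l; apply/orP; right; lia.
  have d64 : 64 * d <= n by lia.
  have : 64 * (2 * (2 * n) * (d * n)) <= 4 * n ^ 3 by nia.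
  have : n ^ 3 <= (2 * m) ^ 3 by rewrite leq_exp2r.
  rewrite expnMn; lia.
Qed.

End Arithmetic.

(** * Counts for [K*] and its recognition up to isomorphism *)

Section KstarStructure.

Local Open Scope nat_scope.

Definition Kstar_core a b : {set Kstar a b} :=
  [set x | if x is inl _ then true else false].

Lemma card_Kstar a b : #|Kstar a b| = a + b.
Proof. by rewrite card_sum !card_ord. Qed.

Lemma Kstar_coreE a b : Kstar_core a b = [set inl i | i : 'I_a].
Proof.
apply/setP => -[i|j]; rewrite inE.
  by apply/esym/imsetP; exists i.
by apply/esym/negbTE/imsetP => -[].
Qed.

Lemma card_Kstar_core a b : #|Kstar_core a b| = a.
Proof.
rewrite Kstar_coreE card_imset; first by rewrite card_ord.
by move=> i j [].
Qed.

Lemma nbh_Kstar a b (x : Kstar a b) :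
  x \notin Kstar_core a b -> nbh x = Kstar_core a b.
Proof.
by case: x => [i|j]; rewrite inE // => _; apply/setP => -[i|j']; rewrite !inE.
Qed.

Lemma Kstar_core_complete a b :
  {in Kstar_core a b &, forall x y, x != y -> adj x y}.
Proof. by move=> [i|i] [j|j]; rewrite ?inE. Qed.

Lemma card_indep_Kstar a b : #|indep_sets (Kstar a b)| = 2 ^ b + a.
Proof.
rewrite (join_card_indep (@nbh_Kstar a b)) card_Kstar card_Kstar_core addKn.
rewrite (join_complete_indep_in (@Kstar_core_complete a b)).
by rewrite card_imset ?card_Kstar_core //; apply: set1_inj.
Qed.

Lemma nbh_sum_Kstar a b : nbh_sum (Kstar a b) = a * (2 ^ b + (b + a) - 2).
Proof.
rewrite (join_nbh_sum (@nbh_Kstar a b)).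
rewrite (join_complete_nbh_sum (@nbh_Kstar a b) (@Kstar_core_complete a b)).
rewrite card_Kstar card_Kstar_core addKn -mulnDr.
case: a => // a; congr (_ * _); have := expn_gt0 2 b; lia.
Qed.

Lemma join_complete_isomorphic (G : sgraph) (D : {set G}) :
  (forall x, x \notin D -> nbh x = D) ->
  {in D &, forall x y, x != y -> adj x y} ->
  isomorphic G (Kstar #|D| (#|G| - #|D|)).
Proof.
move=> nbhD hD; set b := #|G| - #|D|.
have bE : b = #|~: D| by rewrite [RHS]cardsCs setCK.
(* The isomorphism is built in the reverse direction, enumerating [D] on the clique side and its
   complement on the edgeless side. *)
pose g (u : Kstar #|D| b) : G :=
  match u with
  | inl i => enum_val i
  | inr j => enum_val (cast_ord bE j)
  end.
have gD (j : 'I_b) : enum_val (cast_ord bE j) \notin D.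
  by have := enum_valP (cast_ord bE j); rewrite inE.
have g_inj : injective g.
  move=> [i|i] [j|j] /= e.
  - by rewrite (enum_val_inj e).
  - by have := gD j; rewrite -e enum_valP.
  - by have := gD i; rewrite e enum_valP.
  - by rewrite (cast_ord_inj (enum_val_inj e)).
have g_bij : bijective g.
  by apply: inj_card_bij => //; rewrite card_Kstar subnKC ?max_card.
have g_adj : {mono g : x y / adj x y}.
  move=> [i|i] [j|j] /=.
  - rewrite /complete_adj -(inj_eq enum_val_inj).
    have [->|ne] := eqVneq; first exact: adj_irr.
    by apply: hD => //; apply: enum_valP.
  - by rewrite adj_sym -in_nbh nbhD ?gD ?enum_valP.
  - by rewrite -in_nbh nbhD ?gD ?enum_valP.
  - by rewrite -in_nbh nbhD ?gD // (negPf (gD j)).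
case: g_bij => f gK fK; exists f; split; first by exists g.
by move=> x y; rewrite -g_adj !fK.
Qed.

End KstarStructure.

(** This compares the averages of [#|nbhs_of I|] in the two graphs, cross-multiplied to stay in the
    naturals. *)
Lemma nbh_sum_extremal (G : sgraph) (d : nat) :
  (0 < d)%N -> (d <= min_degree G)%N -> (64 <= #|G|)%N -> (64 * d ^ 3 <= #|G|)%N ->
  ~ isomorphic G (Kstar d (#|G| - d)) ->
  (#|indep_sets G| * nbh_sum (Kstar d (#|G| - d)) <
     nbh_sum G * #|indep_sets (Kstar d (#|G| - d))|)%N.
Proof.
move=> d0 dG n64 dn niso.
have [dm dM nd nM] := order_arith d0 n64 dn.
have degG v : (d <= #|nbh v|)%N := leq_trans dG (min_degree_le v).
rewrite card_indep_Kstar nbh_sum_Kstar.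
have nE : (#|G| - d + d = #|G|)%N by lia.
(* Common end of the two cases with many loose sets: no vertex of degree [d], or an uncovered vertex
   [w]. *)
have loose_case c : (forall v : G, #|nbh v| = d -> #|twins v| <= c)%N ->
    (2 ^ c <= #|loose G d| + 1)%N -> (2 * d + 2 <= #|loose G d|)%N ->
    (#|indep_sets G| * (d * (2 ^ (#|G| - d) + (#|G| - d + d) - 2)) <
     nbh_sum G * (2 ^ (#|G| - d) + d))%N.
  move=> hc cB dB; rewrite nE (card_indep_tight_loose G d).
  apply: loose_arith dB _ nM (nbh_sum_ge degG) => //.
  by apply: leq_trans (card_tight_le degG hc) _; rewrite leq_mul2l cB orbT.
have [v0 dv0|nov] := pickP (fun v : G => #|nbh v| == d); last first.
  (* Every singleton is loose here, and the bound on twin classes is vacuous, so [c = 0] works. *)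
  have hB : (#|G| <= #|loose G d|)%N.
    by apply: card_loose_ge_order => v; rewrite ltn_neqAle eq_sym nov degG.
  apply: (loose_case 0%N) => [v /eqP| |]; [by rewrite nov|by rewrite addn1|lia].
have [v /eqP dv vmax] := @arg_maxnP _ v0 (fun v : G => #|nbh v| == d) (fun v => #|twins v|) dv0.
have [|/forallPn[w]] := boolP [forall w, (w \in nbh v) || (w \in twins v)]; last first.
  rewrite negb_or => /andP[wN wT].
  have B1 := card_loose_ge_twins degG dv wN wT.
  have B2 := card_loose_ge_pairs degG dv.
  (* With [B1] this gives [#|twins v| <= #|loose G d|]; adding [B2] yields [2 * #|loose G d| >= #|G|
     - d >= 4 * d + 4]. *)
  have c2 := ltn_expl #|twins v| (isT : 1 < 2)%N.
  apply: (loose_case #|twins v|) => [u du| |]; [exact/vmax/eqP|lia|lia].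
move=> /forallP cov.
have nbhD x : x \notin nbh v -> nbh x = nbh v.
  by move=> /negPf xN; have := cov x; rewrite xN inE => /eqP.
(* If [nbh v] is a clique, [G] is isomorphic to [K*]; otherwise a non-adjacent pair yields more than
   [d] nonempty independent sets inside [nbh v]. *)
have [c|] := boolP [forall x in nbh v, forall y in nbh v, (x != y) ==> adj x y].
  case: niso; rewrite -dv; apply: join_complete_isomorphic => // x y xD yD xy.
  by have /forall_inP/(_ y yD)/implyP := forall_inP c x xD; apply.
rewrite negb_forall_in => /exists_inP[x xD].
rewrite negb_forall_in => /exists_inP[y yD].
rewrite negb_imply => /andP[xy nxy].
have t_gt := join_card_indep_in_gt xD yD xy nxy.
rewrite (join_card_indep nbhD) (join_nbh_sum nbhD) dv in t_gt *.
apply: leq_trans (join_arith d0 dm dM t_gt) _.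
rewrite leq_mul2r leq_add2l -sum_nat_const; apply/orP; right.
by apply: leq_sum => J; rewrite -dv; apply: join_nbhs_of_ge.
Qed.

(* Expected size and the growth condition on [d] *)
From mathcomp Require Import all_classical all_reals all_analysis.
Import numFieldNormedType.Exports.
Local Open Scope classical_set_scope.
Local Open Scope ring_scope.

Lemma card_indep_gt0 (G : sgraph) : (0 < #|indep_sets G|)%N.
Proof. by rewrite (card_indep_tight_loose G 0) addn1. Qed.

(** This is [sum_card_indep] divided by twice the number of independent sets. *)
Lemma EX_nbh_sum (R : realType) (G : sgraph) :
  EX R G = (#|G|%:R - (nbh_sum G)%:R / #|indep_sets G|%:R) / 2.
Proof.
have i0 : #|indep_sets G|%:R != 0 :> R.
  by rewrite pnatr_eq0 -lt0n card_indep_gt0.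
have := congr1 (fun k => k%:R : R) (sum_card_indep G).
rewrite natrD !natrM => e.
have -> : EX R G = (\sum_(I in indep_sets G) #|I|)%:R / #|indep_sets G|%:R.
  rewrite natr_sum mulr_suml [RHS]big_mkcond /=; apply: eq_bigr => I _.
  by rewrite /uniform_pmf; case: ifP => _; rewrite ?mul0r // mulrC.
have -> : #|G|%:R = (2 * (\sum_(I in indep_sets G) #|I|)%:R + (nbh_sum G)%:R)
    / #|indep_sets G|%:R :> R by rewrite e mulfK.
by field.
Qed.

Lemma little_o_cube (R : realType) (d : nat -> nat) :
  ((fun n : nat => (d n)%:R : R^o) =o_\oo
     (fun n : nat => (n%:R : R) `^ (3^-1) : R^o)) ->
  \forall n \near \oo, (64 * d n ^ 3 <= n)%N.
Proof.
(* The choice of [4^-1] gives the constant [64 = 4 ^ 3] after cubing. *)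
move=> /eqoP /(_ 4^-1) => H; have /H{H} : 0 < 4^-1 :> R by rewrite invr_gt0.
apply: filterS => n /=.
rewrite ger0_norm // ger0_norm ?powR_ge0 // => h.
have h4 : 4 * (d n)%:R <= (n%:R : R) `^ 3^-1 by move: h; lra.
have : (4 * (d n)%:R) ^+ 3 <= ((n%:R : R) `^ 3^-1) ^+ 3.
  by apply: lerXn2r h4; rewrite nnegrE ?powR_ge0 ?mulr_ge0.
rewrite -powR_mulrn ?powR_ge0 // -powRrM mulVf // powRr1 // exprMn.
by rewrite -natrX -natrX -natrM ler_nat.
Qed.

Theorem corollary4 (R : realType) (d : nat -> nat)
    (d_ge1 : forall n : nat, (1 <= d n)%N)
    (d_o : (fun n : nat => (d n)%:R : R^o) =o_\oo
           (fun n : nat => (n%:R : R) `^ (3^-1) : R^o)) :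
  exists N : nat, forall n : nat, (N <= n)%N ->
  forall G : sgraph, in_class n (d n) G ->
    ~ isomorphic G (Kstar (d n) (n - d n)) ->
    EX R G < EX R (Kstar (d n) (n - d n)) /\
    EX R (Kstar (d n) (n - d n)) < (n%:R - (d n)%:R) / 2.
Proof.
have [N _ hN] := little_o_cube d_o.
exists (maxn 64 N) => n; rewrite geq_max => /andP[n64 /hN /= dn] G [Gn dG] niso.
have [_ _ nd _] := order_arith (d_ge1 n) n64 dn.
have nE : (d n + (n - d n) = n)%N by lia.
have i0 H : 0 < #|indep_sets H|%:R :> R by rewrite ltr0n card_indep_gt0.
rewrite !EX_nbh_sum card_Kstar nE Gn !ltr_pM2r ?invr_gt0 //.
rewrite !ltrD2l !ltrN2 ltr_pdivrMr // mulrAC ltr_pdivlMr //.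
rewrite ltr_pdivlMr // -!natrM !ltr_nat; split.
  by rewrite mulnC -Gn; apply: nbh_sum_extremal; rewrite ?Gn.
(* After cancelling [d n], the upper bound reads [d n < n - 2], which follows from
   [5 * d n + 4 <= n]. *)
rewrite card_indep_Kstar nbh_sum_Kstar ltn_mul2l d_ge1.
have := d_ge1 n; lia.
Qed.
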